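(* The class of bichain graphs is a minimal hereditary class of unbounded clique-width: it has unbounded clique-width, and every proper hereditary subclass of it has bounded clique-width.
   Context: A set of vertices forms a chain if their neighbourhoods are linearly ordered by inclusion. A bichain graph is a bipartite graph admitting a bipartition in which each of the two parts can be divided into at most two chains. A hereditary class is one closed under induced subgraphs. The clique-width of $G$ is the least size of a label set $\Sigma$ such that $G$ can be built using the operations: create a single vertex with label $i\in\Sigma$; for distinct $i,j$, add all edges between vertices labelled $i$ and vertices labelled $j$; relabel all vertices labelled $i$ to $j$; take disjoint unions of already constructed labelled graphs. A class has bounded clique-width if some constant bounds the clique-width of all its members. *)

(* Defs.v *)
From HB Require Import structures.
From mathcomp Require Import all_boot all_order.
Set Implicit Arguments. Unset Strict Implicit. Unset Printing Implicit Defensive.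

Record graph := Graph {
  gV :> finType;
  gadj : rel gV;
  gadj_sym : symmetric gadj;
  gadj_irr : irreflexive gadj }.

Definition induced_sub (H G : graph) : Prop :=
  exists f : gV H -> gV G, injective f /\
    forall x y, @gadj H x y = @gadj G (f x) (f y).

(* A class of graphs is a predicate on graphs. Hereditary = closed under
   induced subgraphs (this includes closure under isomorphism). *)
Definition hereditary (P : graph -> Prop) : Prop :=
  forall G H : graph, induced_sub H G -> P G -> P H.

Definition nbhd (G : graph) (x : gV G) : {set gV G} := [set y | @gadj G x y].

Definition chain (G : graph) (S : {set gV G}) : Prop :=
  forall x y, x \in S -> y \in S ->
    (nbhd x \subset nbhd y) || (nbhd y \subset nbhd x).

Definition independent (G : graph) (S : {set gV G}) : Prop :=
  forall x y, x \in S -> y \in S -> ~~ @gadj G x y.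

(* Union of at most two chains (chains may be empty). *)
Definition two_chains (G : graph) (S : {set gV G}) : Prop :=
  exists S1 S2 : {set gV G}, S = S1 :|: S2 /\ chain S1 /\ chain S2.

Definition bichain (G : graph) : Prop :=
  exists A B : {set gV G},
    A :|: B = setT /\ A :&: B = set0 /\
    independent A /\ independent B /\ two_chains A /\ two_chains B.

Inductive cwexp (k : nat) : Type :=
  | CVert  of 'I_k
  | CJoin  of 'I_k & 'I_k & cwexp k
  | CRelab of 'I_k & 'I_k & cwexp k
  | CUnion of cwexp k & cwexp k.

Fixpoint cwV k (e : cwexp k) : finType :=
  match e with
  | CVert _ => unit
  | CJoin _ _ e' => cwV e'
  | CRelab _ _ e' => cwV e'
  | CUnion e1 e2 => (cwV e1 + cwV e2)%type
  end.

Fixpoint cwlab k (e : cwexp k) : cwV e -> 'I_k :=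
  match e return cwV e -> 'I_k with
  | CVert i => fun _ => i
  | CJoin _ _ e' => @cwlab k e'
  | CRelab i j e' => fun v => if @cwlab k e' v == i then j else @cwlab k e' v
  | CUnion e1 e2 => fun v => match v with inl a => @cwlab k e1 a | inr b => @cwlab k e2 b end
  end.

Fixpoint cwadj k (e : cwexp k) : cwV e -> cwV e -> bool :=
  match e return cwV e -> cwV e -> bool with
  | CVert _ => fun _ _ => false
  | CJoin i j e' => fun u v =>
      @cwadj k e' u v ||
      ((i != j) && (((@cwlab k e' u == i) && (@cwlab k e' v == j)) ||
                    ((@cwlab k e' u == j) && (@cwlab k e' v == i))))
  | CRelab _ _ e' => @cwadj k e'
  | CUnion e1 e2 => fun u v =>
      match u, v with
      | inl a, inl b => @cwadj k e1 a b
      | inr a, inr b => @cwadj k e2 a b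
      | _, _ => false
      end
  end.

Definition cw_le (G : graph) (k : nat) : Prop :=
  #|gV G| = 0 \/
  exists (e : cwexp k) (f : gV G -> cwV e),
    bijective f /\ forall x y, @gadj G x y = @cwadj k e (f x) (f y).

Definition bounded_cw (P : graph -> Prop) : Prop :=
  exists c : nat, forall G, P G -> cw_le G c.

(* Main.v *)
(** Order the vertices of a bichain graph by "levels" and "positions": a vertex
  (l, p) on an even level is adjacent to a vertex (l', p') on an odd level iff
  l' <= l - 3, or |l - l'| = 1 and p' < p.  Every such graph is bichain, and
  conversely every bichain graph arises this way: orient the pair a in A, b in B
  from b to a if a and b are adjacent and from a to b otherwise, and take minus
  the distance from a suitable extremal vertex as the level; unreachable vertices
  go, recursively, far below.

  The full grid of levels and positions has unbounded clique-width: a clique-width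
  expression yields a balanced vertex set with few neighbourhoods outside it, so
  only few levels meet both sides and consecutive levels split almost equally.

  If an induced subgraph H with levels < K and positions < N is excluded, then in
  each window of K consecutive levels the positions split into at most 2N + 1
  intervals each of which misses a level of the window.  The missing levels form a
  staircase; adding the vertices block by block between consecutive staircases, and
  by position inside a block, only boundedly many neighbourhood classes occur. *)

Require Import Defs.
From mathcomp Require Import all_boot zify.
Set Implicit Arguments. Unset Strict Implicit. Unset Printing Implicit Defensive.

(** * Level graphs *)

(* Arguments are (level, position) pairs. *)
Definition below (x y : nat * nat) : bool :=
  (x.1 + 3 <= y.1) || ((x.1.+1 == y.1) || (y.1.+1 == x.1)) && (x.2 < y.2).

Definition zadj (x y : nat * nat) : bool :=
  if odd x.1 then ~~ odd y.1 && below x y else odd y.1 && below y x.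

Lemma zadj_sym : symmetric zadj.
Proof. by move=> x y; rewrite /zadj; case: (odd x.1); case: (odd y.1). Qed.

Lemma zadj_irr : irreflexive zadj.
Proof. by move=> x; rewrite /zadj; case: (odd x.1). Qed.

Definition level_graph (T : finType) (r : T -> nat * nat) : graph :=
  @Graph T (fun x y => zadj (r x) (r y))
    (fun x y => zadj_sym (r x) (r y)) (fun x => zadj_irr (r x)).

(** Order a residue class lexicographically by level, then position. Distinct levels of the class
    are at least 4 apart, so the clause on levels at distance 3 absorbs the one on consecutive
    levels. Neighbourhoods grow along this order on even levels and shrink on odd ones. *)
Lemma level_graph_chain (T : finType) (r : T -> nat * nat) j :
  @chain (level_graph r) [set x | (r x).1 %% 4 == j].
Proof.
have H (x y z : T) : (r x).1 %% 4 = (r y).1 %% 4 ->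
    ((r x).1 < (r y).1) || ((r x).1 == (r y).1) && ((r x).2 <= (r y).2) ->
  if odd (r x).1 then zadj (r y) (r z) -> zadj (r x) (r z)
  else zadj (r x) (r z) -> zadj (r y) (r z).
  move=> exy lexy; have oxy : odd (r x).1 = odd (r y).1 by lia.
  rewrite /zadj /below -oxy; case: (odd _); lia.
move=> x y; rewrite !inE => /eqP hx /eqP hy; have exy : (r x).1 %% 4 = (r y).1 %% 4 by rewrite hx.
case: (boolP (((r x).1 < (r y).1) || ((r x).1 == (r y).1) && ((r x).2 <= (r y).2))) => lexy.
  have := fun z => H x y z exy lexy.
  by case: (odd _) => h; apply/orP; [right|left]; apply/subsetP => z; rewrite !inE; apply: h.
have leyx : ((r y).1 < (r x).1) || ((r y).1 == (r x).1) && ((r y).2 <= (r x).2) by lia.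
have := fun z => H y x z (esym exy) leyx.
by case: (odd _) => h; apply/orP; [left|right]; apply/subsetP => z; rewrite !inE; apply: h.
Qed.

Lemma level_graph_bichain (T : finType) (r : T -> nat * nat) :
  bichain (level_graph r).
Proof.
have two (a b : nat) (S : {set T}) : S = [set x | (r x).1 %% 4 == a] :|: [set x | (r x).1 %% 4 == b] ->
    @two_chains (level_graph r) S.
  by move=> ->; exists [set x | (r x).1 %% 4 == a], [set x | (r x).1 %% 4 == b];
    do !split; apply: level_graph_chain.
exists [set x | ~~ odd (r x).1], [set x | odd (r x).1]; do !split.
- by apply/setP => x; rewrite !inE; case: odd.
- by apply/setP => x; rewrite !inE; case: odd.
- by move=> x y; rewrite !inE /= /zadj => /negPf-> /negPf->.
- by move=> x y; rewrite !inE /= /zadj => -> ->.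
- by apply: (two 0 2); apply/setP => x; rewrite !inE; lia.
- by apply: (two 1 3); apply/setP => x; rewrite !inE; lia.
Qed.

Lemma bichain_hereditary : hereditary bichain.
Proof.
move=> G H [f [_ fadj]] [A [B [AB [AB0 [iA [iB [tA tB]]]]]]].
have pre_ind (S : {set G}) : independent S -> independent (f @^-1: S).
  by move=> iS x y; rewrite !inE fadj; apply: iS.
have pre_chain (S : {set G}) : chain S -> chain (f @^-1: S).
  move=> cS x y; rewrite !inE => /cS/[apply] /orP[] /subsetP h; apply/orP; [left|right];
  by apply/subsetP => z; rewrite !inE !fadj; move: (h (f z)); rewrite !inE.
have pre_two (S : {set G}) : two_chains S -> two_chains (f @^-1: S).
  case=> S1 [S2 [-> [c1 c2]]]; exists (f @^-1: S1), (f @^-1: S2).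
  by rewrite preimsetU; do !split; apply: pre_chain.
exists (f @^-1: A), (f @^-1: B).
rewrite -preimsetU -preimsetI AB AB0 preimsetT preimset0.
by do !split; auto.
Qed.

(** * Cuts with few neighbourhood classes across them *)

Definition cut_classes (k : nat) (G : graph) (X : {set G}) (c : G -> 'I_k) :=
  forall x y z, x \in X -> y \in X -> z \notin X -> c x = c y ->
    gadj x z = gadj y z.

(** Descend through the expression into operands with more than [m] vertices. At the first union
    whose operands both have at most [m], the larger one has more than [m / 2], and its labels serve
    as classes. Equality of the final labels is carried along so that the induction passes later
    joins. *)
Lemma cw_balanced_cut k (e : cwexp k) m : 0 < m < #|cwV e| ->
  exists (X : {set cwV e}) (c : cwV e -> 'I_k),
    m < #|X|.*2 /\ #|X| <= m /\
    forall x y, x \in X -> y \in X -> c x = c y ->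
      cwlab x = cwlab y /\ forall z, z \notin X -> cwadj x z = cwadj y z.
Proof.
elim: e => [i|i j e IH|i j e IH|e1 IH1 e2 IH2] /=.
- by rewrite card_unit; lia.
- case/IH => X [c [h1 [h2 hX]]]; exists X, c; do 2!split => //.
  move=> x y xX yX /hX -/(_ xX yX) [elab eadj]; split=> // z zX.
  by rewrite elab eadj.
- case/IH => X [c [h1 [h2 hX]]]; exists X, c; do 2!split => //.
  by move=> x y xX yX /hX -/(_ xX yX) [elab eadj]; rewrite elab.
rewrite card_sum => /andP[m0 hm].
have inlN (X : {set cwV e1}) z : (inr z : cwV e1 + cwV e2) \notin inl @: X.
  by apply/imsetP => -[].
have inrN (X : {set cwV e2}) z : (inl z : cwV e1 + cwV e2) \notin inr @: X.
  by apply/imsetP => -[].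
have lift1 (X : {set cwV e1}) (c : cwV e1 -> 'I_k) :
    m < #|X|.*2 -> #|X| <= m ->
    (forall x y, x \in X -> y \in X -> c x = c y ->
      cwlab x = cwlab y /\ forall z, z \notin X -> cwadj x z = cwadj y z) ->
  exists (X : {set cwV e1 + cwV e2}) (c : cwV e1 + cwV e2 -> 'I_k),
    m < #|X|.*2 /\ #|X| <= m /\
    forall x y, x \in X -> y \in X -> c x = c y ->
      @cwlab k (CUnion e1 e2) x = @cwlab k (CUnion e1 e2) y /\
      forall z, z \notin X -> @cwadj k (CUnion e1 e2) x z = @cwadj k (CUnion e1 e2) y z.
  move=> h1 h2 hX; exists (inl @: X).
  (* Only values on [X] matter; [cwlab b] is a default element of ['I_k]. *)
  exists (fun v => match v with inl a => c a | inr b => cwlab b end).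
  rewrite card_imset; last by move=> ? ? [].
  do 2!split=> //; move=> _ _ /imsetP[x xX ->] /imsetP[y yX ->] /hX -/(_ xX yX) [elab eadj].
  split=> // -[z|z] //=; rewrite mem_imset => [|? ? []] //; exact: eadj.
have lift2 (X : {set cwV e2}) (c : cwV e2 -> 'I_k) :
    m < #|X|.*2 -> #|X| <= m ->
    (forall x y, x \in X -> y \in X -> c x = c y ->
      cwlab x = cwlab y /\ forall z, z \notin X -> cwadj x z = cwadj y z) ->
  exists (X : {set cwV e1 + cwV e2}) (c : cwV e1 + cwV e2 -> 'I_k),
    m < #|X|.*2 /\ #|X| <= m /\
    forall x y, x \in X -> y \in X -> c x = c y ->
      @cwlab k (CUnion e1 e2) x = @cwlab k (CUnion e1 e2) y /\
      forall z, z \notin X -> @cwadj k (CUnion e1 e2) x z = @cwadj k (CUnion e1 e2) y z.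
  move=> h1 h2 hX; exists (inr @: X).
  exists (fun v => match v with inl a => cwlab a | inr b => c b end).
  rewrite card_imset; last by move=> ? ? [].
  do 2!split=> //; move=> _ _ /imsetP[x xX ->] /imsetP[y yX ->] /hX -/(_ xX yX) [elab eadj].
  split=> // -[z|z] //=; rewrite mem_imset => [|? ? []] //; exact: eadj.
case: (ltnP m #|cwV e1|) => h1.
  by case: IH1 => [|X [c [? [? ?]]]]; [rewrite m0 h1 | apply: (lift1 X c)].
case: (ltnP m #|cwV e2|) => h2.
  by case: IH2 => [|X [c [? [? ?]]]]; [rewrite m0 h2 | apply: (lift2 X c)].
case: (leqP #|cwV e2| #|cwV e1|) => h12.
  apply: (lift1 setT (@cwlab k e1)); rewrite ?cardsT; try lia.
  by move=> x y _ _ ->; split=> // z; rewrite inE.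
apply: (lift2 setT (@cwlab k e2)); rewrite ?cardsT; try lia.
by move=> x y _ _ ->; split=> // z; rewrite inE.
Qed.

Lemma cw_le_cut (G : graph) k m : cw_le G k -> 0 < m < #|G| ->
  exists (X : {set G}) (c : G -> 'I_k),
    m < #|X|.*2 /\ #|X| <= m /\ cut_classes X c.
Proof.
case=> [->|[e [f [fbij fadj]]]]; first by lia.
have finj := bij_inj fbij.
rewrite (bij_eq_card fbij) => /cw_balanced_cut [X [c [h1 [h2 hX]]]].
have cardX : #|f @^-1: X| = #|X| by apply: on_card_preimset; apply: onW_bij.
exists (f @^-1: X), (c \o f); rewrite cardX; do 2!split=> //.
move=> x y z; rewrite !inE !fadj => xX yX zX ce.
by have [_ ->] := hX _ _ xX yX ce.
Qed.

(* Pairing the class of u i with the bit gadj (u i) (v i) separates all i in S. *)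
Lemma ladder (G : graph) k (X : {set G}) (c : G -> 'I_k) (I : finType) (w : I -> nat)
    (S : {set I}) (u v : I -> G) b :
  cut_classes X c -> injective w ->
  (forall i, i \in S -> u i \in X) -> (forall i, i \in S -> v i \notin X) ->
  (forall i j, i \in S -> j \in S -> w i < w j ->
     gadj (u i) (v j) = b /\ gadj (u j) (v i) = ~~ b) ->
  #|S| <= k.*2.
Proof.
move=> cX winj uX vX hS.
have -> : k.*2 = #|{: 'I_k * bool}| by rewrite card_prod card_ord card_bool muln2.
pose h i := (c (u i), gadj (u i) (v i)).
have hlt i j : i \in S -> j \in S -> w i < w j -> h i <> h j.
  move=> iS jS wij [ec ed]; have [e1 e2] := hS i j iS jS wij.
  have e3 := cX _ _ _ (uX i iS) (uX j jS) (vX j jS) ec.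
  have e4 := cX _ _ _ (uX i iS) (uX j jS) (vX i iS) ec.
  (* This reads [b] = [gadj (u i) (v j)] = [gadj (u j) (v j)] = [gadj (u i) (v i)] =
     [gadj (u j) (v i)] = [~~ b]. *)
  have := etrans (esym e1) (etrans e3 (etrans (esym ed) (etrans e4 e2))).
  by clear; case: b.
apply: (@leq_trans #|h @: S|); last exact: max_card.
rewrite card_in_imset // => i j iS jS eh; apply: winj.
by case: (ltngtP (w i) (w j)) => // /hlt; [move=> /(_ iS jS)/(_ eh) | move=> /(_ jS iS)/(_ (esym eh))].
Qed.

(** * Unbounded clique-width *)

Lemma card_fibers (T I : finType) (h : T -> I) (S : {set T}) d :
  (forall i, #|[set x in S | h x == i]| <= d) -> #|S| <= #|I| * d.
Proof.
move=> hd; rewrite -sum1_card (partition_big h xpredT) //= -sum_nat_const.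
by apply: leq_sum => i _; rewrite sum1dep_card; apply: hd.
Qed.

Definition grid m n : graph :=
  level_graph (fun v : 'I_m * 'I_n => (val v.1, val v.2)).

Section GridCut.
Variables (m n k : nat) (X : {set grid m.+1 n.+1}) (c : grid m.+1 n.+1 -> 'I_k).
Hypothesis cX : cut_classes X c.

Let row (l : 'I_m.+1) : {set 'I_n.+1} := [set p | (l, p) \in X].

(** The positions in [row l] but not in [row l'] form a ladder: between consecutive levels adjacency
    depends only on which position is smaller. *)
Lemma card_adjacent_rows (l l' : 'I_m.+1) :
  (l.+1 == l' :> nat) || (l'.+1 == l :> nat) -> #|row l| <= #|row l'| + k.*2.
Proof.
move=> hl; pose S := row l :\: row l'.
have hS : #|S| <= k.*2.
  apply: (@ladder (grid m.+1 n.+1) _ _ _ 'I_n.+1 (fun i => val i) S (fun p => (l, p))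
            (fun p => (l', p)) (odd l) cX) => //.
  - exact: val_inj.
  - by move=> i; rewrite !inE => /andP[].
  - by move=> i; rewrite !inE => /andP[].
  move=> i j _ _ /= hij; rewrite /gadj /= /zadj /below /=.
  by case: (boolP (odd l)); lia.
rewrite -(cardsID (row l') (row l)); apply: leq_add hS.
by apply: subset_leq_card; apply: subsetIr.
Qed.

Lemma card_rows_le (l l' : 'I_m.+1) : #|row l| <= #|row l'| + k.*2 * m.
Proof.
have H d : forall l l' : 'I_m.+1, (l + d == l' :> nat) || (l' + d == l :> nat) ->
    #|row l| <= #|row l'| + k.*2 * d.
  elim: d => [|d IH] a b hab.
    by have -> : a = b by [apply: val_inj => /=; lia]; rewrite muln0 addn0.
  (* One step from level [a] towards level [b]. *)
  pose x := if a < b then a.+1 else a.-1.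
  have hx : x < m.+1 by rewrite /x; have := ltn_ord b; have := ltn_ord a; case: ifP; lia.
  have h1 : #|row a| <= #|row (Ordinal hx)| + k.*2.
    by apply: card_adjacent_rows; rewrite /= /x; case: ifP; lia.
  have h2 : #|row (Ordinal hx)| <= #|row b| + k.*2 * d.
    by apply: IH; rewrite /= /x; case: ifP; lia.
  by rewrite mulnS addnA addnAC (leq_trans h1) // leq_add2r.
pose d := if l < l' then l' - l else l - l'.
apply: leq_trans (H d l l' _) _; first by rewrite /d; case: ifP; lia.
rewrite leq_add2l leq_mul2l; apply/orP; right; rewrite /d.
have := ltn_ord l; have := ltn_ord l'; case: ifP; lia.
Qed.

Let mixed : {set 'I_m.+1} := [set l | (row l != set0) && (row l != setT)].

(* Ladders need levels in a fixed residue class mod 4, and a fixed side of the cut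
   for the sample vertex on the next level: eight classes of at most 2k rows. *)
Lemma card_mixed_rows : #|mixed| <= 16 * k + 1.
Proof.
pose next (l : 'I_m.+1) : grid m.+1 n.+1 := (inord l.+1, ord0).
(* The top level has no next level, so [next] is meaningless there; the summand 1 pays for it. *)
pose S := mixed :\ ord_max.
have -> : 16 * k + 1 = 1 + #|{: 'I_4 * bool}| * k.*2.
  by rewrite card_prod card_ord card_bool; lia.
rewrite (cardsD1 ord_max) leq_add ?leq_b1 //.
apply: (@card_fibers _ _ (fun l : 'I_m.+1 => (inord (l %% 4) : 'I_4, next l \in X))).
case=> j b.
pose inX l := odflt ord0 [pick p in row l].
pose outX l := odflt ord0 [pick p in ~: row l].
have inXP l : l \in mixed -> (l, inX l) \in X.
  rewrite inE => /andP[/set0Pn[x xl] _]; rewrite /inX; case: pickP => [y|/(_ x)].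
    by rewrite inE.
  by rewrite /= xl.
have outXP l : l \in mixed -> (l, outX l) \notin X.
  rewrite inE => /andP[_]; rewrite -subTset => /subsetPn[x _ xl].
  rewrite /outX; case: pickP => [y|/(_ x)]; first by rewrite !inE.
  by rewrite /= in_setC xl.
(* Here [a'] is at least [a + 4], so levels [a'] and [a + 1] are still 3 apart: both adjacencies
   depend on the parity of the levels alone. *)
have hadj (a a' : 'I_m.+1) p q : a != ord_max -> a' != ord_max ->
    inord (a %% 4) = j -> inord (a' %% 4) = j -> a < a' ->
    (@gadj (grid m.+1 n.+1) (a, p) (inord a'.+1, q) = odd j) /\
    (@gadj (grid m.+1 n.+1) (a', p) (inord a.+1, q) = ~~ odd j).
  rewrite -!val_eqE /= => ha ha' ja ja' haa.
  have e1 : a %% 4 = j by rewrite -ja inordK // ltn_mod.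
  have e2 : a' %% 4 = j by rewrite -ja' inordK // ltn_mod.
  have := ltn_ord a; have := ltn_ord a' => l1 l2.
  rewrite /gadj /= /zadj /below /= !inordK; try lia.
  have -> : odd a = odd j by lia.
  have -> : odd a' = odd j by lia.
  by case: (boolP (odd j)); lia.
(* If the samples lie in [X], they are paired with vertices of their rows outside [X]; otherwise
   with vertices of their rows inside [X]. *)
case: b.
  apply: (@ladder (grid m.+1 n.+1) _ _ _ 'I_m.+1 (fun i => val i) _ next
            (fun l => (l, outX l)) (~~ odd j) cX) => //.
  - exact: val_inj.
  - by move=> i; rewrite !inE xpair_eqE => /and3P[_ _ /eqP].
  - by move=> i; rewrite !in_set xpair_eqE => /andP[/andP[_ ?] _]; apply: outXP; rewrite inE.
  move=> a a'; rewrite !in_set !in_set1 !xpair_eqE => /and3P[/andP[h1 _] /eqP h2 _] /and3P[/andP[h3 _] /eqP h4 _] haa.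
  have [e1 e2] := hadj a a' (outX a) ord0 h1 h3 h2 h4 haa.
  have [e3 e4] := hadj a a' (outX a') ord0 h1 h3 h2 h4 haa.
  by rewrite /next negbK gadj_sym [X in _ /\ X = _]gadj_sym.
apply: (@ladder (grid m.+1 n.+1) _ _ _ 'I_m.+1 (fun i => val i) _ (fun l => (l, inX l))
          next (odd j) cX) => //.
- exact: val_inj.
- by move=> i; rewrite !in_set xpair_eqE => /andP[/andP[_ ?] _]; apply: inXP; rewrite inE.
- by move=> i; rewrite !inE xpair_eqE => /and3P[_ _ /eqP->].
move=> a a'; rewrite !in_set !in_set1 !xpair_eqE => /and3P[/andP[h1 _] /eqP h2 _] /and3P[/andP[h3 _] /eqP h4 _] haa.
have [e1 e2] := hadj a a' (inX a) ord0 h1 h3 h2 h4 haa.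
have [e3 e4] := hadj a a' (inX a') ord0 h1 h3 h2 h4 haa.
by [].
Qed.

(** Row sizes differ by at most [n], so an empty and a full row cannot coexist. If some row is
    empty, [X] lives on mixed rows; if none is, the complement does. *)
Lemma grid_cut_unbalanced : k.*2 * m <= n ->
  #|X| <= (16 * k + 1) * n.+1 \/ #|~: X| <= (16 * k + 1) * n.+1.
Proof.
move=> hn.
have bound (Y : {set grid m.+1 n.+1}) : (forall l p, (l, p) \in Y -> l \in mixed) ->
    #|Y| <= (16 * k + 1) * n.+1.
  move=> hY; apply: (@leq_trans #|setX mixed [set: 'I_n.+1]|).
    by apply: subset_leq_card; apply/subsetP => -[l p] /hY lm; rewrite in_setX lm inE.
  by rewrite cardsX cardsT card_ord leq_mul2r card_mixed_rows orbT.
case: (pickP (fun l => row l == set0)) => [l0 /eqP h0|hne]; [left|right]; apply: bound => l p hp.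
  rewrite in_set; apply/andP; split; first by apply/set0Pn; exists p; rewrite inE.
  apply/eqP => hT; have := card_rows_le l l0.
  by rewrite hT h0 cardsT card_ord cards0; lia.
rewrite in_set hne /=; apply: contraTneq hp => hT; rewrite in_setC negbK.
by have := in_setT p; rewrite -hT in_set.
Qed.

End GridCut.

Lemma bichain_unbounded_cw : ~ bounded_cw bichain.
Proof.
(* [q] exceeds the bound on mixed rows by one. A cut at half of the [4 * q] rows leaves more than
   [q] rows' worth of vertices on each side. *)
case=> k hk; pose q := 16 * k + 2; pose m := (4 * q).-1.
pose n := k.*2 * m; have em : m.+1 = 4 * q by rewrite /m /q; lia.
have hc : #|grid m.+1 n.+1| = 4 * (q * n.+1).
  by rewrite card_prod !card_ord em mulnA.
have q0 : 0 < q * n.+1 by rewrite muln_gt0 /q addn2.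
have cw : cw_le (grid m.+1 n.+1) k by apply: hk; apply: level_graph_bichain.
have [|X [c [h1 [h2 cX]]]] := cw_le_cut (m := 2 * (q * n.+1)) cw.
  by rewrite hc; lia.
have := cardsC X; rewrite hc.
have e : q * n.+1 = (16 * k + 1) * n.+1 + n.+1 by rewrite -mulSnr /q; congr (_ * _); lia.
case: (grid_cut_unbalanced cX (leqnn _)); rewrite -/n; lia.
Qed.

(** * Linear constructions *)

(** A labelled form of [cw_le] for the graph induced on [X]: prescribing the labels allows a
    construction to be continued. *)
Definition built k (T : finType) (X : {set T}) (lab : T -> 'I_k) (adj : rel T) :=
  exists (e : cwexp k) (g : cwV e -> T),
    [/\ injective g, X = g @: setT, forall x, cwlab x = lab (g x)
      & forall x y, cwadj x y = adj (g x) (g y)].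

Section Built.
Variables (k : nat) (T : finType).
Implicit Types (X Y : {set T}) (lab : T -> 'I_k) (adj : rel T).

Lemma eq_built X lab lab' adj adj' :
  {in X, lab =1 lab'} -> {in X &, adj =2 adj'} ->
  built X lab adj -> built X lab' adj'.
Proof.
move=> elab eadj [e [g [ginj gX glab gadj]]]; exists e, g.
have gin x : g x \in X by rewrite gX imset_f.
by split=> // [x|x y]; rewrite ?glab ?elab ?gadj ?eadj.
Qed.

Lemma built_vertex v lab adj : adj v v = false -> built [set v] lab adj.
Proof.
move=> vv; exists (CVert (lab v)), (fun=> v); split=> //; first by move=> [] [].
apply/setP => x; rewrite inE; apply/eqP/imsetP => [->|[y _ ->]] //; by exists tt.
Qed.

Lemma built_union X Y lab adj :
  [disjoint X & Y] -> built X lab adj -> built Y lab adj ->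
  built (X :|: Y) lab (fun u v => ((u \in X) == (v \in X)) && adj u v).
Proof.
move=> dXY [e [g [ginj gX glab gadj]]] [e' [g' [ginj' gX' glab' gadj']]].
have gin x : g x \in X by rewrite gX imset_f.
have gin' x : g' x \in X = false.
  by apply: (disjointFl dXY); rewrite gX' imset_f.
exists (CUnion e e'), (fun x : cwV e + cwV e' => match x with inl a => g a | inr a => g' a end).
split.
- case=> x [] y /=.
  + by move/ginj->.
  + by move=> exy; have := gin x; rewrite exy gin'.
  + by move=> exy; have := gin y; rewrite -exy gin'.
  + by move/ginj'->.
- apply/setP => u; rewrite in_setU gX gX'; apply/orP/imsetP.
    by case=> /imsetP[x _ ->]; [exists (inl x) | exists (inr x)].
  by case=> -[x|x] _ ->; [left|right]; apply: imset_f.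
- by case=> x /=; rewrite ?glab ?glab'.
- by case=> x [y|y] /=; rewrite ?gin ?gin' ?gadj ?gadj' ?eqxx.
Qed.

Lemma built_joins i (s : seq 'I_k) X lab adj : i \notin s -> built X lab adj ->
  built X lab (fun u v => [|| adj u v, (lab u == i) && (lab v \in s)
                            | (lab v == i) && (lab u \in s)]).
Proof.
elim: s => [_|j s IH]; first by apply: eq_built => // u v _ _; rewrite !in_nil !andbF !orbF.
rewrite inE negb_or => /andP[nij /IH{}IH] /IH [e [g [ginj gX glab gadj]]].
exists (CJoin i j e), g; split=> // x y /=; rewrite gadj !glab nij /= !inE.
by do ![case: (_ == _) => //=]; rewrite ?orbT ?orbF ?andbF //= ?orbT.
Qed.

(** Labels are renamed one at a time. Idempotence of [g] ensures that a label already renamed is not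
    changed by a later renaming. *)
Lemma built_relabel (g : 'I_k -> 'I_k) X lab adj : (forall l, g (g l) = g l) ->
  built X lab adj -> built X (g \o lab) adj.
Proof.
move=> gg bX.
suff [e [h [hinj hX hlab hadj]]] :
    built X (fun u => if lab u \in enum 'I_k then g (lab u) else lab u) adj.
  by exists e, h; split=> // x; rewrite hlab mem_enum.
elim: (enum 'I_k) => [|l s [e [h [hinj hX hlab hadj]]]]; first exact: eq_built bX.
exists (CRelab l (g l) e), h; split=> // x /=; rewrite hlab inE.
case: (lab (h x) =P l) => [->|nl] /=.
  by case: (l \in s); rewrite ?if_same ?eqxx.
by case: (lab (h x) \in s); case: eqP => // <-; rewrite gg.
Qed.

(** Every label occurring in [X] is renamed to the label of a canonical representative of its [sim]
    class; representatives represent themselves, so the renaming is idempotent. *)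
Lemma built_merge X lab adj (sim : rel T) : equivalence_rel sim ->
  {in X &, forall u v, lab u = lab v -> sim u v} -> built X lab adj ->
  exists lab', built X lab' adj /\ {in X &, forall u v, (lab' u == lab' v) = sim u v}.
Proof.
move=> /equivalence_relP[sxx sim_eq] hlab bX.
pose canon u := odflt u [pick v in X | sim u v].
have canonP u : u \in X -> (canon u \in X) && sim u (canon u).
  by move=> uX; rewrite /canon; case: pickP => //= /(_ u); rewrite uX sxx.
have canon_eq u v : u \in X -> v \in X -> sim u v -> canon u = canon v.
  move=> uX vX uv; rewrite /canon (@eq_pick _ _ [pred w in X | sim v w]).
    by case: pickP => //= /(_ v); rewrite inE vX sxx.
  by move=> w; rewrite /= (sim_eq _ _ uv).
pose g l := if [pick u in X | lab u == l] is Some u then lab (canon u) else l.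
have gE u : u \in X -> g (lab u) = lab (canon u).
  move=> uX; rewrite /g; case: pickP => [v /andP[vX /eqP/hlab]|/(_ u)]; last by rewrite uX eqxx.
  by move/(_ vX uX)/(canon_eq _ _ vX uX) ->.
exists (g \o lab); split.
  apply: built_relabel bX => l; rewrite {2 3}/g; case: pickP => [u /andP[uX _]|h].
    have /andP[cX uc] := canonP u uX.
    by rewrite gE // -(canon_eq u (canon u)).
  by rewrite /g; case: pickP => // u; rewrite h.
move=> u v uX vX /=; rewrite !gE //.
have /andP[cuX ucu] := canonP u uX; have /andP[cvX vcv] := canonP v vX.
apply/eqP/idP => [/hlab -/(_ cuX cvX)|/(canon_eq _ _ uX vX)->] //.
by rewrite -(sim_eq _ _ ucu) => h; rewrite (sim_eq _ _ h) -(sim_eq _ _ vcv) sxx.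
Qed.

(** The neighbours of [v] in [X] form a union of label classes, so joining the fresh label [f] to
    the labels of these classes creates exactly the edges at [v]. *)
Lemma built_add_vertex v f X lab adj :
  symmetric adj -> irreflexive adj -> v \notin X -> {in X, forall u, lab u != f} ->
  {in X &, forall u w, lab u = lab w -> adj u v = adj w v} -> built X lab adj ->
  built (v |: X) (fun u => if u == v then f else lab u) adj.
Proof.
move=> asym airr vX hf hadj bX.
pose lab1 u := if u == v then f else lab u.
have nv u : u \in X -> (u == v) = false by move=> uX; apply: contraNF vX => /eqP<-.
have b1 : built ([set v] :|: X) lab1 (fun u w => ((u \in [set v]) == (w \in [set v])) && adj u w).
  apply: built_union; first by rewrite disjoints1.
    by apply: built_vertex; apply: airr.
  by apply: eq_built bX => // u uX; rewrite /lab1 nv.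
pose s := [seq l <- enum 'I_k | [exists u in X, (lab u == l) && adj u v]].
have fs : f \notin s.
  by rewrite mem_filter negb_and; apply/orP; left; apply/exists_inP => -[u uX /andP[/eqP e _]];
    have := hf u uX; rewrite e eqxx.
have ins u : u \in X -> (lab u \in s) = adj u v.
  move=> uX; rewrite mem_filter mem_enum andbT; apply/exists_inP/idP => [[w wX /andP[/eqP e]]|uv].
    by rewrite (hadj _ _ wX uX).
  by exists u; rewrite ?eqxx.
apply: eq_built (built_joins fs b1) => // u w; rewrite !inE /lab1.
case/predU1P => [->|uX]; case/predU1P => [->|wX]; rewrite ?eqxx ?nv //=.
- by rewrite (negPf fs) airr.
- by rewrite (negPf (hf w wX)) ins // asym orbF.
- by rewrite (negPf (hf u uX)) ins.
- by rewrite !(negPf (hf _ _)) //= orbF.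
Qed.

End Built.

Lemma built_cw_le (G : graph) k (lab : G -> 'I_k) :
  built setT lab (@gadj G) -> cw_le G k.
Proof.
case=> e [g [ginj gT _ gadjE]]; right.
have gsurj u : exists x, g x == u.
  by have := in_setT u; rewrite gT => /imsetP[x _ ->]; exists x.
pose f u := xchoose (gsurj u); have fK : cancel f g by move=> u; apply/eqP/(xchooseP (gsurj u)).
exists e, f; split; last by move=> x y; rewrite gadjE !fK.
by exists g => // x; apply: ginj; rewrite fK.
Qed.

(** Vertices are added in the order of [key], and labels are merged after each addition so that they
    are exactly the neighbourhood classes towards the vertices still to come. At most [k] labels are
    then in use; the extra one is for the next vertex. *)
Lemma linear_cw_le (G : graph) (key : G -> nat) k : injective key ->
  (forall i, exists c : G -> 'I_k, forall u w v,
     key u < i -> key w < i -> i <= key v -> c u = c w -> gadj u v = gadj w v) ->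
  cw_le G k.+1.
Proof.
move=> kinj hc.
pose X i := [set u | key u < i].
pose sim i u w := [forall v, (i <= key v) ==> (@gadj G u v == @gadj G w v)].
have simP i u w : reflect (forall v, i <= key v -> gadj u v = gadj w v) (sim i u w).
  by apply: (iffP forallP) => h v; [move=> iv; apply/eqP; apply: (implyP (h v))
    | apply/implyP => iv; apply/eqP/h].
have sim_equiv i : equivalence_rel (sim i).
  apply/equivalence_relP; split; first by move=> u; apply/simP.
  move=> u w /simP h v; apply/simP/simP => h' z iz; first by rewrite -h // h'.
  by rewrite h // h'.
(* The empty segment is separate because every expression has a vertex. *)
have main i : X i = set0 \/ exists lab : G -> 'I_k.+1, built (X i) lab (@gadj G) /\
    {in X i &, forall u w, (lab u == lab w) = sim i u w}.
  elim: i => [|i IH]; first by left; apply/setP => u; rewrite !inE.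
  case: (pickP (fun v => key v == i)) => [v /eqP kv|nov]; last first.
    have eX : X i.+1 = X i by apply/setP => u; rewrite !inE ltnS leq_eqVlt nov.
    case: IH => [X0|[lab [bX hlab]]]; [by left; rewrite eX | right; exists lab].
    rewrite eX; split=> // u w uX wX; rewrite hlab //; apply/simP/simP => h z iz; apply: h.
      exact: ltnW.
    by rewrite ltn_neqAle iz eq_sym nov.
  right.
  have eX : X i.+1 = v |: X i.
    by apply/setP => u; rewrite !inE ltnS leq_eqVlt -(inj_eq kinj) kv.
  have vX : v \notin X i by rewrite inE kv ltnn.
  suff [lab [bX hlab]] : exists lab : G -> 'I_k.+1, built (X i.+1) lab (@gadj G) /\
      {in X i.+1 &, forall u w, lab u = lab w -> sim i.+1 u w}.
    exact: built_merge bX.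
  case: IH => [X0|[lab [bX hlab]]].
    exists (fun=> ord0); rewrite eX X0 setU0; split; first by apply: built_vertex; apply: gadj_irr.
    by move=> u w; rewrite !inE => /eqP-> /eqP-> _; apply/simP.
  (* Were all [k.+1] labels used, their representatives would be pairwise inequivalent, hence
     separated by [c], which has only [k] values. *)
  have [f hf] : exists f, {in X i, forall u, lab u != f}.
    case: (pickP (fun f => [forall u in X i, lab u != f])) => [f /forall_inP hf|nf].
      by exists f.
    have /fin_all_exists[r hr] (l : 'I_k.+1) : exists u, (u \in X i) && (lab u == l).
      by move/negbT: (nf l); rewrite negb_forall => /existsP[u]; rewrite negb_imply negbK; exists u.
    have [c cP] := hc i.
    suff /leq_card : injective (c \o r) by rewrite !card_ord ltnn.
    move=> l l' /= e; have /andP[rX /eqP<-] := hr l; have /andP[rX' /eqP<-] := hr l'.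
    apply/eqP; rewrite hlab //; apply/simP => z iz.
    by apply: cP e => //; [move: rX | move: rX']; rewrite inE.
  exists (fun u => if u == v then f else lab u); rewrite eX; split.
    apply: built_add_vertex => //; [exact: gadj_sym | exact: gadj_irr |].
    by move=> u w uX wX /eqP; rewrite hlab // => /simP; apply; rewrite kv.
  have nv u : u \in X i -> (u == v) = false by move=> uX; apply: contraNF vX => /eqP<-.
  move=> u w; rewrite !in_setU !in_set1.
  case/predU1P => [->|uX]; case/predU1P => [->|wX]; rewrite ?eqxx ?nv // => e.
  - by apply/simP.
  - by have := hf _ wX; rewrite -e eqxx.
  - by have := hf _ uX; rewrite e eqxx.
  - by move/eqP: e; rewrite hlab // => /simP h; apply/simP => z /ltnW; apply: h.
have XT : X (\max_(u : G) key u).+1 = setT.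
  by apply/setP => u; rewrite !inE ltnS leq_bigmax.
case: (main (\max_(u : G) key u).+1); rewrite XT.
  by move=> T0; left; rewrite -cardsT T0 cards0.
by case=> lab [/built_cw_le].
Qed.

(** * Excluding an induced subgraph *)

(** Positions are distinct across all levels, so that a single position never meets two levels and a
    block together with a position identifies a vertex. *)
Definition level_rep (G : graph) (r : G -> nat * nat) : Prop :=
  injective (fun v => (r v).2) /\ forall u v : G, gadj u v = zadj (r u) (r v).

(** An even shift preserves the parities of levels, and positions matter only between consecutive
    levels. *)
Lemma zadj_eq a x y x' y' : ~~ odd a -> x'.1 = a + x.1 -> y'.1 = a + y.1 ->
  (x.1.+1 = y.1 \/ y.1.+1 = x.1 ->
     (x.2 < y.2) = (x'.2 < y'.2) /\ (y.2 < x.2) = (y'.2 < x'.2)) ->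
  zadj x y = zadj x' y'.
Proof.
move=> ha ex ey h; rewrite /zadj /below ex ey !oddD (negPf ha) /=.
have -> : (a + x.1).+1 == a + y.1 = (x.1.+1 == y.1) by lia.
have -> : (a + y.1).+1 == a + x.1 = (y.1.+1 == x.1) by lia.
rewrite -!addnA !leq_add2l.
case: (x.1.+1 =P y.1) => e1; first by have [-> ->] := h (or_introl e1).
by case: (y.1.+1 =P x.1) => e2 //; have [-> ->] := h (or_intror e2).
Qed.

(** * Intervals of positions inside one window of levels *)

Section Windows.
Variables (G : graph) (r : G -> nat * nat) (K : nat).
Hypotheses (r_rep : level_rep r) (K_gt1 : 1 < K).

Definition full w s t :=
  [forall j : 'I_K, exists v : G, ((r v).1 == w * K + j) && (s <= (r v).2 < t)].

Lemma fullP w s t : reflect (forall j, j < K -> exists v : G,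
  (r v).1 = w * K + j /\ s <= (r v).2 < t) (full w s t).
Proof.
apply: (iffP forallP) => h j.
  by move=> jK; have /existsP[v /andP[/eqP e1 e2]] := h (Ordinal jK); exists v.
by have [v [e1 e2]] := h j (ltn_ord j); apply/existsP; exists v; rewrite e1 e2 eqxx.
Qed.

Lemma full_lt w s t : full w s t -> s < t.
Proof. by move/fullP => /(_ 0) [|v [_ ]]; lia. Qed.

Lemma not_full w s t : ~~ full w s t ->
  exists2 j, j < K & forall v : G, s <= (r v).2 < t -> (r v).1 <> w * K + j.
Proof.
rewrite negb_forall => /existsP[j /existsPn h]; exists j => // v hv e.
by have := h v; rewrite e eqxx hv.
Qed.

(** [im.1] maps a position to the index of its interval, of which there are at most [2 * N + 1];
    [im.2] maps an index to the offset of a level that this interval misses. *)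
Definition staircase w N s (im : (nat -> nat) * (nat -> nat)) : Prop :=
  [/\ {homo im.1 : x y / x <= y}, forall x, im.1 x <= N.*2, forall i, im.2 i < K
    & forall v : G, s <= (r v).2 -> (r v).1 <> w * K + im.2 (im.1 (r v).2)].

(* Greedy: cut the coordinate axis at the least t for which [s, t) meets every
   level of the window; both [s, t - 1) and the single coordinate t - 1 then
   miss a level. *)
Lemma full_intervals_or_staircase w N s :
  (exists t : nat -> nat, t 0 = s /\ forall i, i < N -> full w (t i) (t i.+1)) \/
  (exists im, staircase w N s im).
Proof.
have [pinj _] := r_rep.
pose P := (\max_(v : G) (r v).2).+1.
have ltP v : (r v).2 < P by rewrite ltnS (leq_bigmax v).
elim: N s => [|N IH] s; first by left; exists (fun=> s).
case: (boolP (full w s P)) => [fP|/not_full[j jK hj]]; last first.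
  right; exists (fun=> 0, fun=> j); split=> //= v sv; apply: hj.
  by rewrite sv ltP.
have [t ft tmin] := ex_minnP (ex_intro (fun t => full w s t) P fP).
have st := full_lt ft.
have /not_full[j0 j0K hj0] : ~~ full w s t.-1.
  by apply/negP => /tmin; lia.
(* At most one vertex has position [t.-1], while the window has at least two levels. *)
have /not_full[j1 j1K hj1] : ~~ full w t.-1 t.
  apply/negP => /fullP h; have [|v [v1 v2]] := h 0; first by lia.
  have [v' [v1' v2']] := h 1 K_gt1.
  have e : v = v' by apply: pinj => /=; lia.
  by move: v1'; rewrite -e v1; lia.
case: (IH t) => [[t' [t0 ht']]|[[io m] [/= homo_io ioN mK hm]]].
  left; exists (fun i => if i is i'.+1 then t' i' else s); split=> // -[|i] iN.
    by rewrite t0.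
  exact: ht'.
(* Two new intervals precede the recursive ones, whose indices shift by 2; hence the bound
   [N.*2]. *)
right; exists (fun x => if x < t.-1 then 0 else if x == t.-1 then 1 else (io x).+2,
               fun i => match i with 0 => j0 | 1 => j1 | i'.+2 => m i' end).
split=> /=.
- move=> x y xy; case: (ltnP x t.-1) => // h1; rewrite ltnNge (leq_trans h1 xy) /=.
  case: eqP => e1; case: eqP => e2 //; first by lia.
  by rewrite !ltnS homo_io.
- by move=> x; have := ioN x; case: ifP => // _; case: ifP => // _; lia.
- by case=> [|[|i]].
move=> v sv; case: ltnP => h1; first by apply: hj0; rewrite sv.
case: eqP => h2; first by apply: hj1; lia.
by apply: hm; lia.
Qed.

(** A vertex of [H] at level [l] and position [p] goes to a vertex at level [w * K + l] with
    position in the interval from [t p] to [t p.+1]. Successive intervals preserve the order of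
    positions, and [w * K] is even. *)
Lemma full_intervals_induced (H : graph) (rH : H -> nat * nat) w N (t : nat -> nat) :
  level_rep rH -> ~~ odd K -> (forall v, (rH v).1 < K) -> (forall v, (rH v).2 < N) ->
  (forall i, i < N -> full w (t i) (t i.+1)) -> induced_sub H G.
Proof.
case=> pinj adjH K_even hK hN ht; have [_ adjG] := r_rep.
have /fin_all_exists[f hf] (v : H) : exists u : G, (r u).1 = w * K + (rH v).1 /\
    t (rH v).2 <= (r u).2 < t (rH v).2.+1.
  by have /fullP := ht _ (hN v); apply; apply: hK.
have t_homo i j : i <= j -> j <= N -> t i <= t j.
  elim: j => [|j IH]; first by rewrite leqn0 => /eqP->.
  rewrite leq_eqVlt => /predU1P[->//|ij jN].
  by apply: leq_trans (IH _ (ltnW jN)) (ltnW (full_lt (ht j jN))).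
have lt_f x y : (rH x).2 < (rH y).2 -> (r (f x)).2 < (r (f y)).2.
  move=> xy; have [_ /andP[_ h1]] := hf x; have [_ /andP[h2 _]] := hf y.
  by apply: leq_trans h1 (leq_trans (t_homo _ _ xy (ltnW (hN y))) h2).
exists f; split=> [x y exy|x y].
  apply: pinj => /=; case: (ltngtP (rH x).2 (rH y).2) => // /lt_f.
    by rewrite exy ltnn.
  by rewrite exy ltnn.
case: (x =P y) => [->|nxy]; first by rewrite !gadj_irr.
rewrite adjH adjG; have [ex _] := hf x; have [ey _] := hf y.
apply: (zadj_eq (a := w * K)) => //; first by rewrite oddM (negPf K_even) andbF.
move=> _; case: (ltngtP (rH x).2 (rH y).2) => [h|h|/pinj//].
  by have := lt_f _ _ h; lia.
by have := lt_f _ _ h; lia.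
Qed.

End Windows.

(** * Linear construction along the staircases *)

Section Staircases.
Variables (G : graph) (r : G -> nat * nat) (K N W : nat).
Variable im : nat -> (nat -> nat) * (nat -> nat).
Hypotheses (r_rep : level_rep r) (K_gt1 : 1 < K).
Hypothesis imP : forall w, w < W -> staircase r K w N 0 (im w).
Hypothesis W_big : forall v, (r v).1 %/ K + 1 < W.

Let io w x := (im w).1 x.
(** At position [x], the staircase of window [w] runs through the missed level [w * K + cut w x]. *)
Let cut w x := (im w).2 ((im w).1 x).
Let window v := (r v).1 %/ K.
Let block v := window v + (cut (window v) (r v).2 < (r v).1 %% K).

Let block_lt v : block v < W.
Proof. by have := W_big v; rewrite /block /window; case: (cut _ _ < _); lia. Qed.

Let level_split v : (r v).1 = window v * K + (r v).1 %% K /\ (r v).1 %% K < K.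
Proof. by split; [exact: divn_eq | rewrite ltn_mod ltnW]. Qed.

Let cut_lt w v : w < W -> cut w (r v).2 < K.
Proof. by case/imP => _ _ h _; apply: h. Qed.

(* Block w lies above the staircase of window w - 1 and below that of window w. *)
Let below_own_cut v : (r v).1 < block v * K + cut (block v) (r v).2.
Proof.
have [e lt] := level_split v; rewrite {1}e /block.
case: (ltnP (cut _ _) _) => h /=; first by rewrite mulnDl mul1n; lia.
rewrite addn0 ltn_add2l ltn_neqAle h andbT; apply/eqP => h'.
have [_ _ _ hc] : staircase r K (window v) N 0 (im (window v)).
  by apply: imP; have := W_big v; rewrite /window; lia.
by case: (hc v isT); rewrite {1}e h'.
Qed.

Let above_cut w v : w < block v -> w * K + cut w (r v).2 < (r v).1.
Proof.
move=> wb; have [e lt] := level_split v; rewrite e.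
have cw : cut w (r v).2 < K by apply: cut_lt; apply: ltn_trans wb (block_lt v).
case: (ltnP w (window v)) => hw.
  apply: leq_trans (leq_addr _ _); apply: leq_trans (_ : w.+1 * K <= _).
    by rewrite mulSn; lia.
  by rewrite leq_mul2r hw orbT.
move: wb; rewrite /block; case: (ltnP (cut _ _) _) => h; last by lia.
by move=> wb; have -> : w = window v by [lia]; rewrite ltn_add2l.
Qed.

Let level_lower v : block v * K <= (r v).1 + K.
Proof.
have [e lt] := level_split v; rewrite /block mulnDl.
by case: (cut _ _ < _); lia.
Qed.

Let level_upper v : (r v).1 < block v * K + K.
Proof. by have := below_own_cut v; have := cut_lt v (block_lt v); clear; lia. Qed.

(** The level of [u] is at most [block u * K + K - 2], whereas [v] lies strictly above the staircase
    of window [block u + 1], hence at level at least [block u * K + K + 1]. *)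
Lemma block_far u v : block u + 1 < block v -> (r u).1 + 3 <= (r v).1.
Proof.
move=> h; have h1 := below_own_cut u; have h2 := cut_lt u (block_lt u).
have h3 := above_cut h.
by move: h3; rewrite mulnDl mul1n; lia.
Qed.

(** In a common interval the missed level would lie strictly between [u] and [v], whose levels would
    then differ by at least 2. *)
Lemma block_separated u v : block u < block v ->
  (r u).1.+1 = (r v).1 \/ (r v).1.+1 = (r u).1 ->
  io (block u) (r u).2 <> io (block u) (r v).2.
Proof.
move=> h adj; have h1 := below_own_cut u; have h2 := above_cut h.
by move: h1 h2; rewrite /cut -!/(io _ _) => h1 h2 e'; move: h2; rewrite -e'; clear -h1 adj; lia.
Qed.

(** A block is contained in [K.*2] consecutive levels. *)
Lemma block_eq_level u v : block u = block v ->
  (r u).1 = (r v).1 %[mod K.*2] -> (r u).1 = (r v).1.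
Proof.
wlog le_uv : u v / (r u).1 <= (r v).1.
  by move=> H; case: (leqP (r u).1 (r v).1) => [|/ltnW] /H h b m //; rewrite h.
move=> eb /esym/eqP; rewrite eqn_mod_dvd // => dv.
have := level_lower u; have := level_upper v; rewrite eb => h1 h2.
case: (posnP ((r v).1 - (r u).1)) => [|h3]; first by lia.
by have := dvdn_leq h3 dv; lia.
Qed.

Lemma staircases_cw_le : cw_le G #|{: 'I_3 * 'I_K.*2.+1 * 'I_N.*2.+1}|.+1.
Proof.
have [pinj adjG] := r_rep.
pose P := (\max_(v : G) (r v).2).+1.
have ltP v : (r v).2 < P by rewrite ltnS (leq_bigmax v).
pose key v := block v * P + (r v).2.
have key_div v : key v %/ P = block v by rewrite divnMDl // divn_small ?addn0.
have key_mod v : key v %% P = (r v).2 by rewrite modnMDl modn_small.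
apply: (linear_cw_le (key := key)) => [u v e|i].
  by apply: pinj; rewrite -[LHS]key_mod e key_mod.
(* The class records how many blocks [u] lies behind the current one, capped at 2, its level modulo
   [K.*2], and its interval in the staircase above its block. Bounds are written as successors for
   [inord]. *)
pose cls u : 'I_3 * 'I_K.*2.+1 * 'I_N.*2.+1 :=
  (inord (minn (i %/ P - block u) 2), inord ((r u).1 %% K.*2), inord (io (block u) (r u).2)).
exists (fun u => enum_rank (cls u)) => u w v ui wi iv /enum_rank_inj[].
have ub : block u <= i %/ P by rewrite -key_div leq_div2r // ltnW.
have wb : block w <= i %/ P by rewrite -key_div leq_div2r // ltnW.
have vb : i %/ P <= block v by rewrite -key_div leq_div2r.
have ioK x : io (block x) (r x).2 < N.*2.+1.
  by have [_ h _ _] := imP (block_lt x); rewrite ltnS h.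
have modK x : x %% K.*2 < K.*2.+1 by rewrite ltnW // ltnS ltn_mod; lia.
move=> /(congr1 val) /=; rewrite !inordK ?ltnS ?geq_minr // => tag.
move=> /(congr1 val) /=; rewrite !inordK // => lev.
move=> /(congr1 val) /=; rewrite !inordK // => ioe.
rewrite !adjG; have par : odd (r u).1 = odd (r w).1.
  have := congr1 odd lev; rewrite -!muln2 => h.
  by rewrite (divn_eq (r u).1 (K * 2)) (divn_eq (r w).1 (K * 2)) !oddD !oddM /= !andbF /= h.
(* Two or more blocks behind, [u] and [w] are at least 3 levels below [v], and parity decides. *)
case: (ltnP (block u + 1) (i %/ P)) => hu.
  have hw : block w + 1 < i %/ P.
    by move: tag hu; move: (block u) (block w) (i %/ P) => a b d; clear; lia.
  have := block_far (leq_trans hu vb); have := block_far (leq_trans hw vb).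
  rewrite /zadj /below par; move: (r u) (r v) (r w) => [l1 p1] [l2 p2] [l3 p3] /=; clear.
  by case: (odd _); case: (odd _) => //=; lia.
have eb : block u = block w.
  by move: tag hu ub wb; move: (block u) (block w) (i %/ P) => a b d; clear; lia.
have eul : (r u).1 = (r w).1 := block_eq_level eb lev.
(* For [v] in a later block, its interval differs from the common interval of [u] and [w], and
   monotonicity gives the same comparison of positions. In the same block, [v] has the larger
   position because it comes later. *)
apply: (zadj_eq (a := 0)) => //= adj; case: (ltnP (block u) (block v)) => hv.
  have [homo _ _ _] := imP (block_lt u).
  move: ioe (block_separated hv adj); rewrite -eb /io.
  have := homo (r u).2 (r v).2; have := homo (r v).2 (r u).2.
  have := homo (r w).2 (r v).2; have := homo (r v).2 (r w).2.
  move: (r u).2 (r v).2 (r w).2 ((im _).1) => a b d f; clear; lia.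
have euv : block u = block v.
  by move: ub hv vb; move: (block u) (block v) (i %/ P) => a b d; clear; lia.
move: ui wi iv; rewrite /key -eb -euv.
by move: (block u * P) (r u).2 (r v).2 (r w).2 => a b d f; clear; lia.
Qed.

End Staircases.

Lemma bounded_choice (T : Type) (x0 : T) (P : nat -> T -> Prop) W :
  (forall w, exists x, P w x) -> exists f, forall w, w < W -> P w (f w).
Proof.
move=> hP; have /fin_all_exists[f hf] (w : 'I_W) : exists x, P w x by apply: hP.
exists (fun w => if insub w is Some i then f i else x0) => w wW.
by rewrite insubT; apply: (hf (Ordinal wW)).
Qed.

Lemma no_induced_sub_cw_le (G H : graph) (r : G -> nat * nat) (rH : H -> nat * nat) K N :
  level_rep r -> level_rep rH -> 1 < K -> ~~ odd K ->
  (forall v, (rH v).1 < K) -> (forall v, (rH v).2 < N) -> ~ induced_sub H G ->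
  cw_le G #|{: 'I_3 * 'I_K.*2.+1 * 'I_N.*2.+1}|.+1.
Proof.
move=> rG rHP K1 K_even hK hN nsub.
(* One more window than is occupied, since a vertex above its staircase belongs to the next
   block. *)
pose W := (\max_(v : G) ((r v).1 %/ K + 1)).+1.
have [im imP] : exists im, forall w, w < W -> staircase r K w N 0 (im w).
  apply: (@bounded_choice _ (id, id) (fun w => staircase r K w N 0)) => w.
  case: (full_intervals_or_staircase rG K1 w N 0) => // -[t [_ ht]].
  by case: nsub; apply: full_intervals_induced rHP K_even hK hN ht.
apply: (staircases_cw_le rG K1 imP) => v.
by rewrite ltnS (leq_bigmax (F := fun v : G => (r v).1 %/ K + 1)).
Qed.

(** * Level representations of bichain graphs *)

(* The columns are the classes of (side, idx): in a bichain graph, the four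
   chains, with v dominating u when every arc into u is also an arc into v. *)
Section BipartiteTournament.
Variables (T : finType) (arc : rel T) (side idx : T -> bool).

Definition dominated u v := [forall z, arc z u ==> arc z v].

Hypothesis arc_side : forall u v, arc u v -> side v = ~~ side u.
Hypothesis arcC : forall u v, side v = ~~ side u -> arc u v = ~~ arc v u.
Hypothesis dominated_total : forall u v, side u = side v -> idx u = idx v ->
  dominated u v || dominated v u.

Lemma arc_dominated z u v : dominated u v -> arc z u -> arc z v.
Proof. by move=> /forallP/(_ z)/implyP. Qed.

Lemma arc_asym u v : arc u v -> arc v u = false.
Proof. by move=> uv; have := arcC (arc_side uv); rewrite uv; case: (arc v u). Qed.

(** The vertex [w] has an arc into [v] but none into [u], so totality leaves only one direction. The
    sides of [u] and [v] agree because each arc switches side. *)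
Lemma arc_between w u v : idx u = idx v -> arc u w -> arc w v ->
  dominated u v /\ ~~ dominated v u.
Proof.
move=> euv uw wv; have nvu : ~~ dominated v u.
  by apply/negP => /arc_dominated/(_ wv); rewrite arc_asym.
split=> //; have := dominated_total _ euv; rewrite (negPf nvu) orbF; apply.
by rewrite (arc_side wv) (arc_side uw) negbK.
Qed.

Definition indeg v := #|[set z | arc z v]|.

Lemma indeg_lt v : indeg v < #|T|.
Proof.
rewrite -cardsT; apply: proper_card; apply/properP; split; first exact: subsetT.
by exists v; rewrite ?inE //; apply/negP => vv; have := arc_side vv; case: side.
Qed.

Lemma indeg_strict u v : dominated u v -> ~~ dominated v u -> indeg u < indeg v.
Proof.
move=> uv; rewrite negb_forall => /existsP[z]; rewrite negb_imply => /andP[zv zu].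
apply: proper_card; apply/properP; split.
  by apply/subsetP => w; rewrite !inE; apply: arc_dominated.
by exists z; rewrite inE.
Qed.

(** A vertex of maximal in-degree in the column works, since strict domination increases the
    in-degree. *)
Lemma column_top (S : {set T}) u0 : u0 \in S ->
  exists t, [/\ t \in S, side t = side u0, idx t = idx u0 &
    forall u, u \in S -> side u = side u0 -> idx u = idx u0 -> dominated u t].
Proof.
move=> u0S.
pose P u := [&& u \in S, side u == side u0 & idx u == idx u0].
have P0 : P u0 by rewrite /P u0S !eqxx.
case: (arg_maxnP indeg P0) => t /and3P[tS /eqP ts /eqP ti] tmax; exists t; split=> // u uS us ui.
have := @dominated_total u t; rewrite us ui ts ti => /(_ erefl erefl).
case: (boolP (dominated u t)) => //= nut tu.
have := tmax u; rewrite /P uS us ui !eqxx => /(_ isT) h.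
by have := leq_trans (indeg_strict tu nut) h; rewrite ltnn.
Qed.

(** The extremal vertex from which distances are measured. The last condition confines its
    successors in [S] to a single column. *)
Definition start (S : {set T}) v0 j := [/\ v0 \in S,
  forall u, u \in S -> side u = side v0 -> idx u = idx v0 -> dominated u v0 &
  forall u, u \in S -> side u = ~~ side v0 -> idx u = j -> ~~ arc v0 u].

(** Take the top [t] of a column. If it has an arc into an opposite column, let [t'] be the top of
    that one; then [t] has an arc to [t']. An arc from [t'] back into the column of [t] would give
    an arc from [t'] to [t], so [t'] is a start. *)
Lemma exists_start (S : {set T}) : S != set0 -> exists v0 j, start S v0 j.
Proof.
case/set0Pn => u0 /column_top[t [tS ts ti ttop]].
have {}ttop u : u \in S -> side u = side t -> idx u = idx t -> dominated u t.
  by move=> uS; rewrite ts ti; apply: ttop.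
case: (pickP (fun u => [&& u \in S, idx u & arc t u])) => [u /and3P[uS ui tu]|no].
  have [t' [t'S t's t'i t'top]] := column_top uS.
  exists t', (idx t); split=> // [w|w] wS ws wi.
    by apply: t'top; rewrite // ?ws ?wi.
  apply/negP => t'w; have tt' : arc t t' by apply: arc_dominated tu; apply: t'top.
  have : arc t' t.
    by apply: arc_dominated t'w; apply: ttop => //; rewrite ws t's (arc_side tu) negbK.
  by rewrite arc_asym.
exists t, true; split=> // u uS us ui; apply/negP => tu.
by have := no u; rewrite uS ui tu.
Qed.

(** * Distance layers around a starting vertex *)

Section Layers.
Variables (S : {set T}) (v0 : T) (j : bool).
Hypothesis v0j : start S v0 j.

(* [fix_order F v] is 1 plus the distance from v0 to v, and 0 if v is unreachable. *)
Let F (X : {set T}) := [set v in S | (v == v0) || [exists u in X, arc u v]].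

Let F_mono : {homo F : X Y / X \subset Y}.
Proof.
move=> X Y /subsetP XY; apply/subsetP => v; rewrite !inE => /andP[-> /orP[->//|/exists_inP[u uX uv]]].
by apply/orP; right; apply/exists_inP; exists u; rewrite ?XY.
Qed.

Let R := fixset F.
Let d := fix_order F.

Let d_gt0 v : (0 < d v) = (v \in R). Proof. exact: fix_order_gt0. Qed.

Let d_iter v k : (v \in iter k F set0) = (0 < d v <= k).
Proof. exact: in_iter_fixE. Qed.

Let d_start : d v0 = 1.
Proof.
have [v0S _ _] := v0j; have : v0 \in iter 1 F set0 by rewrite /= inE v0S eqxx.
by rewrite d_iter; lia.
Qed.

Let d_arc u v : u \in R -> v \in S -> arc u v -> v \in R /\ d v <= (d u).+1.
Proof.
move=> uR vS uv; have : v \in iter (d u).+1 F set0.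
  rewrite iterS inE vS; apply/orP; right; apply/exists_inP; exists u => //.
  by rewrite d_iter leqnn andbT d_gt0.
by rewrite d_iter d_gt0 => /andP[].
Qed.

Let d_pred v k : v \in R -> d v = k.+1 ->
  (k = 0 /\ v = v0) \/ exists2 u, d u = k & arc u v /\ u \in R.
Proof.
move=> vR dv; have : v \in iter k.+1 F set0 by rewrite d_iter d_gt0 vR dv /=.
rewrite iterS inE => /andP[vS /orP[/eqP ev|/exists_inP[u]]].
  by left; split=> //; move: dv; rewrite ev d_start => -[].
rewrite d_iter d_gt0 => /andP[uR duk] uv; right; exists u => //.
by have [_] := d_arc uR vS uv; lia.
Qed.

Let R_sub v : v \in R -> v \in S.
Proof. by rewrite -d_gt0 => h; have : v \in iter (d v) F set0; [rewrite d_iter h /=|case: (d v) => [|k]; rewrite inE // => /andP[]]. Qed.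

Let d_side v : v \in R -> side v = side v0 (+) ~~ odd (d v).
Proof.
move: {2}(d v) (erefl (d v)) => k; elim: k v => [|k IH] v dv vR.
  by move: vR; rewrite -d_gt0 dv.
case: (d_pred vR dv) => [[k0 ->]|[u du [uv uR]]]; first by rewrite d_start addbF.
by rewrite (arc_side uv) (IH u) // du dv /=; case: (side v0); case: (odd k).
Qed.

(* A shortest path from v0 never turns back: if w -> u -> v with w and v in the
   same column, then v already dominates w. *)
Let d_idx v : v \in R ->
  idx v = (if odd (d v) then idx v0 else j) (+) odd (d v)./2.
Proof.
have [_ v0top v0j'] := v0j.
move: {2}(d v) (erefl (d v)) => k; elim/ltn_ind: k v => -[|k] IH v dv vR.
  by move: vR; rewrite -d_gt0 dv.
case: (d_pred vR dv) => [[k0 ->]|[u du [uv uR]]]; first by rewrite d_start addbF.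
case: k => [|k] in IH dv du *; first by move: uR; rewrite -d_gt0 du.
case: (d_pred uR du) => [[k0 eu]|[w dw [wu wR]]].
  (* Here [u] is [v0], which has no arc into column [j]. *)
  move: dv; rewrite k0 => -> /=; rewrite addbT.
  have := v0j' v (R_sub vR); rewrite -eu uv => /(_ (arc_side uv)).
  by case: (idx v) j => [] [] // /(_ erefl).
rewrite dv /= negbK; have := IH k _ w dw wR; rewrite dw => IHw.
have {}IHw : idx w = (if odd k then idx v0 else j) (+) odd k./2 by apply: IHw; lia.
rewrite addbN -IHw; case: (idx v =P idx w) => [e|]; last by case: idx; case: idx.
exfalso; have [wv nvw] := arc_between (esym e) wu uv.
have sv : side v = side w by rewrite (arc_side uv) (arc_side wu) negbK.
case: k => [|k] in IH dv du dw {IHw} *; first by move: wR; rewrite -d_gt0 dw.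
(* If [w] is [v0], then it dominates [v], a contradiction; otherwise a predecessor [z] of [w] has an
   arc to [v], which is then too close to [v0]. *)
case: (d_pred wR dw) => [[k0 ew]|[z dz [zw zR]]].
  by case/negP: nvw; rewrite ew; apply: v0top; rewrite -?ew // R_sub.
by have [_] := d_arc zR (R_sub vR) (arc_dominated wv zw); rewrite dv dz; clear; lia.
Qed.

Let d_idx_eq u v : u \in R -> v \in R -> d u = d v -> idx u = idx v.
Proof. by move=> uR vR e; rewrite (d_idx uR) (d_idx vR) e. Qed.

Let d_max v : d v <= #|T|. Proof. exact: fix_order_le_max. Qed.

(* Positions in layer i are multiples of (#|T|.+1) ^ (#|T| - i), which leaves
   room to insert the next layer just above its largest predecessors. *)
Let unit i := #|T|.+1 ^ (#|T| - i).
Let pos := fix pos i v :=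
  if i is i'.+1 then
    \max_(u | (u \in R) && (d u == i') && arc u v) pos i' u + (indeg v).+1 * unit i
  else 0.

Let unit_gt0 i : 0 < unit i. Proof. by rewrite expn_gt0. Qed.

Let unitS i : i < #|T| -> unit i = #|T|.+1 * unit i.+1.
Proof. by move=> h; rewrite /unit -expnS; congr (_ ^ _); lia. Qed.

Let pos_dvd i v : i <= #|T| -> unit i %| pos i v.
Proof.
elim: i v => [|i IH] v iT; first exact: dvdn0.
apply: dvdn_add; last exact: dvdn_mull.
apply: (@dvdn_trans (unit i)); first by rewrite (unitS iT) dvdn_mull.
by apply: (big_ind (fun x => unit i %| x)) => [|x y hx hy|u _];
  rewrite ?dvdn0 //; [case: (leqP x y) | apply: IH (ltnW iT)].
Qed.

(** The maximum over predecessors is monotone under domination, and the in-degree makes the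
    comparison strict. *)
Let pos_lt i u v : dominated u v -> ~~ dominated v u -> pos i.+1 u < pos i.+1 v.
Proof.
move=> uv nvu; rewrite /=; rewrite -addnS; apply: leq_add; last first.
  by rewrite ltn_mul2r unit_gt0 ltnS indeg_strict.
apply/bigmax_leqP => z /andP[zR zu]; apply: leq_bigmax_cond.
by rewrite zR (arc_dominated uv zu).
Qed.

Let pos_arc u v : u \in R -> arc u v -> pos (d u) u < pos (d u).+1 v.
Proof.
move=> uR uv; rewrite /= -addn1 leq_add //; last by rewrite muln_gt0 unit_gt0.
by apply: leq_bigmax_cond; rewrite uR eqxx.
Qed.

(** Every predecessor [z] of [v] in the layer of [u] is strictly dominated by [u], so its position
    is smaller by at least one full [unit (d u)]. What [v] adds to the largest of these is less than
    that unit. *)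
Let pos_arcV u v : u \in R -> v \in R -> d v = (d u).+1 -> arc v u ->
  pos (d v) v < pos (d u) u.
Proof.
move=> uR vR dv vu; have dT := d_max v.
have u_dvd : unit (d u) %| pos (d u) u by apply: pos_dvd; apply: d_max.
have [i du] : exists i, d u = i.+1.
  by exists (d u).-1; rewrite prednK // d_gt0.
have u_gt0 : 0 < pos (d u) u.
  by rewrite du /= addn_gt0 muln_gt0 unit_gt0 orbT.
have small : (indeg v).+1 * unit (d u).+1 < unit (d u).
  rewrite [unit (d u)]unitS -?dv // ltn_mul2r unit_gt0 ltnS.
  exact: indeg_lt.
have u_ge := dvdn_leq u_gt0 u_dvd.
suff : \max_(z | (z \in R) && (d z == d u) && arc z v) pos (d u) z <= pos (d u) u - unit (d u).
  by rewrite dv /=; move: small u_ge; move: (unit _) (_ * _) (\max_(_ | _) _) (pos _ _); lia.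
apply/bigmax_leqP => z /andP[/andP[zR /eqP dz] zv].
have [zu nuz] := arc_between (d_idx_eq zR uR dz) zv vu.
have zlt : pos (d u) z < pos (d u) u by rewrite du pos_lt.
have z_dvd : unit (d u) %| pos (d u) z by apply: pos_dvd; apply: d_max.
have := dvdn_leq _ (dvdn_sub u_dvd z_dvd); rewrite subn_gt0 => /(_ zlt).
by move: u_ge zlt; clear; lia.
Qed.

(** No arc leaves [R] within [S], and [R] is placed at least 3 levels above the rest. Inside [R], an
    arc descends by one level, ascends by one level, or ascends by at least 3; positions settle the
    first two cases. *)
Lemma layers_extend :
  (forall R' : {set T}, R' \proper S -> exists l' p' : T -> nat,
     (forall v, v \in R' -> odd (l' v) = side v) /\
     {in R' &, forall u v, arc u v -> below (l' u, p' u) (l' v, p' v)}) ->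
  exists l' p' : T -> nat,
    (forall v, v \in S -> odd (l' v) = side v) /\
    {in S &, forall u v, arc u v -> below (l' u, p' u) (l' v, p' v)}.
Proof.
have [v0S _ _] := v0j; have v0R : v0 \in R by rewrite -d_gt0 d_start.
case/(_ (S :\: R)) => [|l' [p' [l'_odd l'_below]]].
  apply/properP; split; first exact: subsetDl.
  by exists v0 => //; rewrite inE v0R.
pose M := \max_v l' v; have leM v : l' v <= M by apply: leq_bigmax.
(* The parity of [C] puts [v0], at level [C - 1], on the parity of its side. *)
pose C := ((M + #|T| + 3).*2 + ~~ side v0)%N.
have dC v : M + 3 + d v <= C by have := d_max v; rewrite /C; clear; lia.
exists (fun v => if v \in R then C - d v else l' v).
exists (fun v => if v \in R then pos (d v) v else p' v).
split=> [v vS|u v uS vS uv].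
  case: ifP => vR; last by apply: l'_odd; rewrite inE vR.
  have dCv : d v <= C by have := dC v; clear; lia.
  rewrite oddB // (d_side vR) /C oddD odd_double oddb.
  by case: (side v0); case: (odd (d v)).
case: (boolP (u \in R)) => uR.
  have [vR dvu] := d_arc uR vS uv; rewrite vR.
  have odd_d : odd (d v) = ~~ odd (d u).
    by have := arc_side uv; rewrite (d_side uR) (d_side vR); case: (side v0); case: (odd (d u)); case: (odd (d v)).
  have dCu := dC u; have dCv := dC v.
  case: (ltngtP (d v) (d u)) => h.
  - case: (d u =P (d v).+1) => h1.
      have := pos_arcV vR uR h1 uv; rewrite /below /= => ->; rewrite andbT.
      by move: dCu dCv h1; clear; lia.
    rewrite /below /=; apply/orP; left.
    by move: dCu dCv odd_d h h1; move: (d u) (d v); clear; lia.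
  - have h1 : d v = (d u).+1 by move: dvu h; clear; lia.
    have := pos_arc uR uv; rewrite -h1 /below /= => ->; rewrite andbT.
    by move: dCu dCv h1; clear; lia.
  - by move: odd_d; rewrite h; case: (odd _).
case: (boolP (v \in R)) => vR.
  rewrite /below /=; apply/orP; left.
  by have := dC v; have := leM u; clear; lia.
by apply: l'_below; rewrite ?inE ?uR ?vR.
Qed.

End Layers.

Lemma tournament_levels (S : {set T}) : exists l p : T -> nat,
  (forall v, v \in S -> odd (l v) = side v) /\
  {in S &, forall u v, arc u v -> below (l u, p u) (l v, p v)}.
Proof.
move: {2}#|S| (leqnn #|S|) => n; elim: n S => [|n IH] S.
  rewrite leqn0 cards_eq0 => /eqP->; exists (fun=> 0), (fun=> 0).
  by split=> [v|u v]; rewrite inE.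
move=> Sn; case: (eqVneq S set0) => [->|/exists_start[v0 [j vj]]].
  exists (fun=> 0), (fun=> 0).
  by split=> [v|u v]; rewrite inE.
apply: (layers_extend vj) => R' /proper_card R'S.
by apply: IH; rewrite -ltnS (leq_trans R'S).
Qed.

End BipartiteTournament.

(** * From bichain graphs to bipartite tournaments and back *)

Lemma below_asym x y : below x y -> ~~ below y x.
Proof. by rewrite /below; lia. Qed.

Lemma bichain_level_rep (G : graph) : bichain G -> exists r, @level_rep G r.
Proof.
case=> A [B [AB [AB0 [iA [iB [[A1 [A2 [eA [cA1 cA2]]]] [B1 [B2 [eB [cB1 cB2]]]]]]]]]].
have inB u : u \in B = (u \notin A).
  have := in_setT u; have := in_set0 u; rewrite -AB -AB0 !inE.
  by case: (u \in A); case: (u \in B).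
(* Arcs into [A] are the edges, arcs into [B] the non-edges. *)
pose arc (u v : G) := ((u \in A) != (v \in A)) && (gadj u v == (v \in A)).
pose side u := u \notin A.
pose idx u := if u \in A then u \in A1 else u \in B1.
have arc_side u v : arc u v -> side v = ~~ side u.
  by rewrite /arc /side; case: (u \in A); case: (v \in A).
have arcC u v : side v = ~~ side u -> arc u v = ~~ arc v u.
  rewrite /arc /side negbK => e; rewrite -(negbK (v \in A)) e (gadj_sym v u).
  by case: (u \in A); case: (gadj u v).
have col_chain u v : side u = side v -> idx u = idx v ->
    (nbhd u \subset nbhd v) || (nbhd v \subset nbhd u).
  rewrite /side /idx => /negb_inj e; rewrite -e; case: (boolP (u \in A)) => uA.
    have vA := uA; rewrite e in vA; move: uA vA; rewrite eA !inE.
    case: (boolP (u \in A1)) => [u1 _ _ v1|nu1 /= u2 v2 v1]; first by apply: cA1.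
    by apply: cA2 => //; move: v2; rewrite -v1.
  have uB : u \in B by rewrite inB.
  have vB : v \in B by rewrite inB -e.
  move: uB vB; rewrite eB !inE.
  case: (boolP (u \in B1)) => [u1 _ _ v1|nu1 /= u2 v2 v1]; first by apply: cB1.
  by apply: cB2 => //; move: v2; rewrite -v1.
have dom_total u v : side u = side v -> idx u = idx v -> dominated arc u v || dominated arc v u.
  move=> es /(col_chain _ _ es); move: es; rewrite /side => /negb_inj e.
  (* Inclusion of neighbourhoods is domination in [A], and reversed domination in [B], where arcs
     come from non-edges. *)
  have key (x y : G) : (x \in A) = (y \in A) -> nbhd x \subset nbhd y ->
      if x \in A then dominated arc x y else dominated arc y x.
    move=> exy /subsetP xy; have xyz z : gadj z x -> gadj z y.
      by have := xy z; rewrite !inE !(gadj_sym _ z).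
    case: ifP => xA; apply/forallP => z; apply/implyP; rewrite /arc -exy xA => /andP[-> /=].
      by move/eqP/xyz->.
    by move/eqP => zy; apply/eqP; apply: contraFF zy; apply: xyz.
  by case/orP => /key; rewrite -?e => /(_ erefl); case: ifP => _ ->; rewrite ?orbT.
have [l [p [l_odd l_below]]] := tournament_levels arc_side arcC dom_total setT.
have {}l_odd v : odd (l v) = (v \notin A) by apply: l_odd.
(* Ties between positions are broken by rank, making them globally distinct without changing strict
   inequalities. *)
pose q v := (p v * #|G| + enum_rank v)%N.
have q_mod v : q v %% #|G| = enum_rank v by rewrite modnMDl modn_small.
have q_lt u v : p u < p v -> q u < q v.
  move=> h; apply: (@leq_trans ((p u).+1 * #|G|)).
    by rewrite mulSn addnC ltn_add2l.
  by apply: leq_trans (leq_addr _ _); rewrite leq_mul2r h orbT.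
have arc_below u v : arc u v -> below (l u, q u) (l v, q v).
  move=> /l_below -/(_ (in_setT _) (in_setT _)); rewrite /below /= => /orP[->//|/andP[-> /q_lt->]].
  by rewrite orbT.
exists (fun v => (l v, q v)); split=> [u v /= e|].
  by apply: enum_rank_inj; apply: val_inj; rewrite /= -!q_mod e.
have cross u v : u \in A -> v \notin A -> gadj u v = zadj (l u, q u) (l v, q v).
  move=> uA vA; rewrite /zadj /= !l_odd uA vA /=; case: (boolP (gadj u v)) => uv.
    by rewrite arc_below // /arc uA (negPf vA) gadj_sym uv.
  (* A non-edge is an arc in the opposite direction, and [below] is asymmetric. *)
  by apply/esym/negbTE/below_asym/arc_below; rewrite /arc uA (negPf vA) (negPf uv).
move=> u v; case: (boolP (u \in A)) => uA; case: (boolP (v \in A)) => vA.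
- by rewrite (negPf (iA _ _ uA vA)) /zadj /= !l_odd uA vA.
- exact: cross.
- by rewrite gadj_sym zadj_sym cross.
- by rewrite (negPf (iB _ _ _ _)) ?inB // /zadj /= !l_odd uA vA.
Qed.

Theorem theorem13 :
  hereditary bichain /\
  ~ bounded_cw bichain /\
  (forall Q : graph -> Prop,
     hereditary Q ->
     (forall G, Q G -> bichain G) ->
     (exists G, bichain G /\ ~ Q G) ->
     bounded_cw Q).
Proof.
split; first exact: bichain_hereditary.
split; first exact: bichain_unbounded_cw.
move=> Q Qher Qbi [H [/bichain_level_rep[rH rHP] nQH]].
(* Doubling makes [K] even, so windows start at even levels, and the successor ensures [1 < K]. *)
pose K := (\max_(v : H) (rH v).1).+1.*2.
pose N := (\max_(v : H) (rH v).2).+1.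
exists #|{: 'I_3 * 'I_K.*2.+1 * 'I_N.*2.+1}|.+1 => G QG.
have [r rP] := bichain_level_rep (Qbi _ QG).
apply: (no_induced_sub_cw_le rP rHP) => [||v|v|/Qher].
- by rewrite /K; lia.
- by rewrite odd_double.
- by have := leq_bigmax (F := fun v : H => (rH v).1) v; rewrite /K; lia.
- by rewrite ltnS (leq_bigmax (F := fun v : H => (rH v).2) v).
- by move/(_ QG).
Qed.
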